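(* Let $n \geqslant 3$ and let $k$ be a positive integer with $k \geqslant n-3$. Then $$rn_k(C_n) = \begin{cases} \left(\frac{n-2}{2}\right)(2k+3-n) + k - \frac{n}{2} + 1 & \text{if } n \text{ is even},\\ \left(\frac{n-1}{2}\right)(2k+3-n) & \text{if } n \text{ is odd}.\end{cases}$$
   Context: $C_n$ is the cycle on vertex set $\mathbb{Z}_n = \{0,1,\ldots,n-1\}$, with $u,v$ adjacent iff $u \equiv v \pm 1 \pmod n$; $d(u,v)$ is the graph distance. For a positive integer $k$, a radio-$k$-labeling of a graph $G$ is a function $f \colon V(G) \to \{0,1,2,\ldots\}$ such that $|f(u)-f(v)| \geqslant k - d(u,v) + 1$ for all distinct $u,v$. The span of $f$ is $\max\{|f(u)-f(v)| : u,v \in V(G)\}$, and the radio-$k$-number $rn_k(G)$ is the minimum span over all radio-$k$-labelings of $G$. *)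

(* Defs.v *)
From HB Require Import structures.
From mathcomp Require Import all_boot all_order all_algebra.
From mathcomp Require Import boolp.

Set Implicit Arguments.
Unset Strict Implicit.
Unset Printing Implicit Defensive.

Import Order.TTheory GRing.Theory Num.Theory.

Local Open Scope ring_scope.

Section Radio.
Variables (T : finType) (e : rel T).

Definition walk_of_length (u v : T) (m : nat) : bool :=
  [exists p : m.-tuple T, path e u p && (last u p == v)].

(* A shortest walk visits no vertex twice, so it has fewer than #|T| edges;
   the value is #|T| when v is not reachable from u. *)
Definition graph_dist (u v : T) : nat :=
  find (walk_of_length u v) (iota 0 #|T|).

Definition radio_labeling (k : nat) (f : T -> nat) : Prop :=
  forall u v : T, u != v ->
    k%:Z - (graph_dist u v)%:Z + 1 <= `|(f u)%:Z - (f v)%:Z|.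

Definition span (f : T -> nat) : nat :=
  \max_(u : T) \max_(v : T) `|(f u)%:Z - (f v)%:Z|%N.

Definition is_radio_span (k s : nat) : Prop :=
  exists2 f : T -> nat, radio_labeling k f & span f = s.

Lemma radio_span_exists (k : nat) : exists s : nat, `[< is_radio_span k s >].
Proof.
pose f (x : T) := (k.+1 * enum_rank x)%N.
exists (span f); apply/asboolP; exists f => // u v neq_uv.
have neq_r : (enum_rank u)%:Z - (enum_rank v)%:Z != 0 :> int.
  by rewrite subr_eq0 eqz_nat (inj_eq val_inj) (inj_eq enum_rank_inj).
apply: (@le_trans _ _ k.+1%:Z).
  by rewrite -addn1 PoszD lerD2r gerBl.
rewrite /f !PoszM -mulrBr normrM [`|k.+1%:Z|]ger0_norm // ler_peMr //.
by rewrite -gtz0_ge1 normr_gt0.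
Qed.

Definition radio_number (k : nat) : nat := ex_minn (radio_span_exists k).

End Radio.

(* 'Z_n is the ring of integers modulo n only for n > 1. *)
Definition cycle_graph (n : nat) : rel 'Z_n :=
  fun u v => (u == v + 1) || (u == v - 1).

(* Main.v *)
(** For an injective enumeration x_0, x_1, ... of the vertices by increasing
    label, d(x_i, x_(i+1)) + d(x_(i+1), x_(i+2)) <= n - 1: for even n two
    consecutive antipodal steps would give x_i = x_(i+2).  Hence the label grows
    by at least 2 (k + 1) - (n - 1) = 2k + 3 - n over two steps; for even n one
    step, contributing at least k + 1 - n / 2, is left over.  Conversely, with
    h = ceil(n / 2), taking the vertices in the order 0, h, 1, h + 1, 2, ... can
    meet these bounds with equality, and k >= n - 3 makes the constraints on
    the other pairs hold. *)

Require Import Defs.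
From mathcomp Require Import all_boot all_order all_algebra.
From mathcomp Require Import boolp zify ring.

(** * Arithmetic on representatives: distances, the claimed value, the optimal labels *)

Definition cyclic_dist (n i j : nat) : nat :=
  minn (maxn i j - minn i j) (n - (maxn i j - minn i j)).

Lemma cyclic_distE n i j : i <= j ->
  cyclic_dist n i j = minn (j - i) (n - (j - i)).
Proof. by move=> ij; rewrite /cyclic_dist (maxn_idPr ij) (minn_idPl ij). Qed.

Lemma cyclic_distC n i j : cyclic_dist n i j = cyclic_dist n j i.
Proof. by rewrite /cyclic_dist (maxnC i) (minnC i). Qed.

(** The vertex [i'] is the neighbour of [i] on a shorter arc to [j]; the last disjunct covers the
    step that wraps around between 0 and [n.-1]. *)
Lemma cyclic_dist_stepN n i j m : i < n -> j < n -> cyclic_dist n i j = m.+1 ->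
  exists i', [/\ i' < n, [|| i == i'.+1, i' == i.+1,
     (i == 0) && (i' == n.-1) | (i' == 0) && (i == n.-1)]
   & cyclic_dist n i' j = m].
Proof.
move=> iN jN; case: (leqP i j) => ij.
- rewrite cyclic_distE //; case: (leqP (j - i) (n - (j - i))) => short.
    by exists i.+1; rewrite cyclic_distE; [split; lia|lia].
  case: (posnP i) => [->|i0].
    by exists n.-1; rewrite cyclic_distC cyclic_distE; [split; lia|lia].
  by exists i.-1; rewrite cyclic_distE; [split; lia|lia].
- rewrite cyclic_distC cyclic_distE; last exact: ltnW.
  case: (leqP (i - j) (n - (i - j))) => short.
    by exists i.-1; rewrite cyclic_distC cyclic_distE; [split; lia|lia].
  case: (ltnP i.+1 n) => iS.
    by exists i.+1; rewrite cyclic_distC cyclic_distE; [split; lia|lia].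
  by exists 0; rewrite cyclic_distE; [split; lia|lia].
Qed.

(** The half [n.-1./2] is (n - 1) / 2 for odd n and (n - 2) / 2 for even n, and [~~ odd n] switches
    on the leftover single step. For n >= 3 and k >= n - 3 the truncated subtractions are exact. *)
Definition cycle_radio_number (n k : nat) : nat :=
  n.-1./2 * (2 * k + 3 - n) + ~~ odd n * (k + 1 - n./2).

(** In the order 0, h, 1, h + 1, ... with h = [uphalf n], a vertex v < h has position 2v and any
    other v has position 2(v - h) + 1. Two positions cost [2 * k + 3 - n]; the step from 0 to h
    covers distance [n./2] and costs [k + 1 - n./2]. *)
Definition cycle_labeling (n k v : nat) : nat :=
  if (v < uphalf n) then v * (2 * k + 3 - n)
  else (v - uphalf n) * (2 * k + 3 - n) + (k + 1 - n./2).

Local Open Scope ring_scope.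

Import GRing.Theory Num.Theory.

(** * Graph distance as the least length of a walk *)

Lemma walk_of_length0 (T : finType) (e : rel T) (u v : T) :
  walk_of_length e u v 0 = (u == v).
Proof.
apply/existsP/idP => [[p]|uv]; first by rewrite tuple0.
by exists [tuple].
Qed.

Lemma walk_of_lengthS (T : finType) (e : rel T) (u v : T) (m : nat) :
  walk_of_length e u v m.+1 = [exists w, e u w && walk_of_length e w v m].
Proof.
apply/existsP/existsP => [[p]|[w /andP[uw /existsP[p pP]]]].
  case/tupleP: p => w p /= /andP[/andP[uw wp] lp].
  by exists w; rewrite uw; apply/existsP; exists p; rewrite wp.
by exists [tuple of w :: p]; rewrite /= uw.
Qed.

Lemma graph_distE (T : finType) (e : rel T) (u v : T) (d : nat) :
    (d < #|T|)%N -> walk_of_length e u v d ->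
    (forall m, walk_of_length e u v m -> (d <= m)%N) ->
  graph_dist e u v = d.
Proof.
move=> dT wd dmin; rewrite /graph_dist.
set p := walk_of_length e u v; set s := iota 0 #|T|.
have hp : has p s by apply/hasP; exists d => //; rewrite mem_iota.
have fT : (find p s < #|T|)%N by rewrite -[X in (_ < X)%N](size_iota 0) -has_find.
apply/eqP; rewrite eqn_leq; apply/andP; split.
  rewrite leqNgt; apply/negP => /(before_find 0%N).
  by rewrite nth_iota // add0n /p wd.
by apply: dmin; have := nth_find 0%N hp; rewrite nth_iota.
Qed.

(** * Graph distance in the cycle *)

Section Cycle.
Variable n : nat.
Implicit Types u v w : 'Z_n.+3.

(** Removing the modular arithmetic leaves conditions that linear arithmetic can decide. *)
Lemma cycle_graphE u v : cycle_graph u v =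
  [|| (u == v.+1 :> nat), (v == u.+1 :> nat),
      ((u == 0 :> nat) && (v == n.+2 :> nat))
    | ((v == 0 :> nat) && (u == n.+2 :> nat))]%N.
Proof.
have uP : (u < n.+3)%N := ltn_ord u.
have vP : (v < n.+3)%N := ltn_ord v.
have mod1 : (1 %% n.+3 = 1)%N by rewrite modn_small.
have modB : ((n.+3 - 1) %% n.+3 = n.+2)%N by rewrite modn_small ?subn1.
have -> : cycle_graph u v =
    ((u == (v + 1) %% n.+3 :> nat) || (u == (v + n.+2) %% n.+3 :> nat))%N.
  by rewrite /cycle_graph -!val_eqE /= ?mod1 ?modB.
have -> : ((v + 1) %% n.+3 = if v == n.+2 :> nat then 0 else v.+1)%N.
  case: eqP => [->|vn]; first by rewrite addn1 modnn.
  by rewrite modn_small; lia.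
have -> : ((v + n.+2) %% n.+3 = if v == 0 :> nat then n.+2 else v.-1)%N.
  case: eqP => [->|v0]; first by rewrite modn_small.
  by have -> : (v + n.+2 = v.-1 + n.+3)%N by [lia]; rewrite modnDr modn_small; lia.
clear mod1 modB; move: (nat_of_ord u) (nat_of_ord v) uP vP => i j iP jP.
by case: (eqVneq j n.+2) => ?; case: (eqVneq j 0%N) => ?;
  apply/idP/idP; lia.
Qed.

Lemma cyclic_dist_edge u v w : cycle_graph u w ->
  (cyclic_dist n.+3 u v <= (cyclic_dist n.+3 w v).+1)%N.
Proof.
have uP : (u < n.+3)%N := ltn_ord u.
have vP : (v < n.+3)%N := ltn_ord v.
have wP : (w < n.+3)%N := ltn_ord w.
rewrite cycle_graphE /cyclic_dist; lia.
Qed.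

Lemma cyclic_dist_step u v m : cyclic_dist n.+3 u v = m.+1 ->
  exists2 w, cycle_graph u w & cyclic_dist n.+3 w v = m.
Proof.
case/(cyclic_dist_stepN _ _ _ _ (ltn_ord u) (ltn_ord v)) => w [wP uw wv].
by exists (Ordinal wP : 'Z_n.+3) => //; rewrite cycle_graphE.
Qed.

Lemma cycle_dist u v : graph_dist (@cycle_graph n.+3) u v = cyclic_dist n.+3 u v.
Proof.
have uP : (u < n.+3)%N := ltn_ord u.
have vP : (v < n.+3)%N := ltn_ord v.
apply: graph_distE.
- rewrite card_ord; change (cyclic_dist n.+3 u v < n.+3)%N.
  rewrite /cyclic_dist; lia.
(* A walk of this length exists: keep moving to a neighbour one closer to [v]. *)
- move: {-1}(cyclic_dist _ _ _) (erefl (cyclic_dist n.+3 u v)) => m.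
  elim: m u {uP} => [|m IHm] u.
    move=> uv; rewrite walk_of_length0 -val_eqE /=.
    by move: (ltn_ord u : (u < n.+3)%N) uv; rewrite /cyclic_dist; lia.
  case/cyclic_dist_step => w uw wv; rewrite walk_of_lengthS.
  by apply/existsP; exists w; rewrite uw IHm.
(* No walk is shorter, since an edge lowers the cyclic distance by at most one. *)
- move=> m; elim: m u {uP} => [|m IHm] u.
    by rewrite walk_of_length0 => /eqP->; rewrite /cyclic_dist; lia.
  rewrite walk_of_lengthS => /existsP[w /andP[uw /IHm wv]].
  by apply: leq_trans (cyclic_dist_edge _ v _ uw) _.
Qed.

End Cycle.

(* Unqualified [span] is the linear span of mathcomp's [vector]. *)
Lemma leq_span (T : finType) (f : T -> nat) (u v : T) : (f u - f v <= Defs.span f)%N.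
Proof.
apply: (bigmax_sup u) => //; apply: (bigmax_sup v) => //.
lia.
Qed.

Lemma span_leq (T : finType) (f : T -> nat) (b : nat) :
  (forall u, (f u <= b)%N) -> (Defs.span f <= b)%N.
Proof.
move=> fb; apply/bigmax_leqP => u _; apply/bigmax_leqP => v _.
have := fb u; have := fb v; lia.
Qed.

(** * The lower bound *)

Lemma cycle_span_lower_bound (n k : nat) (f : 'Z_n.+3 -> nat) :
    (n <= k)%N -> radio_labeling (@cycle_graph n.+3) k f ->
  (cycle_radio_number n.+3 k <= Defs.span f)%N.
Proof.
move=> nk fL.
pose s := sort (relpre f leq) (enum 'Z_n.+3).
pose x i := nth 0 s i.
have size_s : size s = n.+3 by rewrite size_sort -cardE card_ord.
have uniq_s : uniq s by rewrite sort_uniq enum_uniq.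
have f_homo i j : (i <= j < n.+3)%N -> (f (x i) <= f (x j))%N.
  case/andP=> ij jn; have total_f : total (relpre f leq).
    by move=> a b; apply: leq_total.
  have trans_f : transitive (relpre f leq).
    by move=> a b c; apply: leq_trans.
  apply: (sorted_leq_nth trans_f _ 0 (sort_sorted total_f _)) => //.
  - by move=> a; rewrite /relpre /=.
  - by rewrite inE size_s; lia.
  - by rewrite inE size_s; lia.
have x_neq i j : (i < j < n.+3)%N -> x i != x j.
  by case/andP=> ij jn; rewrite nth_uniq ?size_s //; lia.
(* Weak monotonicity along the sorted enumeration already removes the absolute value from the radio
   condition. *)
have f_dist i j : (i < j < n.+3)%N ->
    (f (x i) + k + 1 <= f (x j) + cyclic_dist n.+3 (x i) (x j))%N.
  move=> ij; have := fL _ _ (x_neq _ _ ij); rewrite cycle_dist.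
  have := f_homo i j; lia.
have x_lt i : (x i < n.+3)%N := ltn_ord (x i).
have step1 i : (i.+1 < n.+3)%N -> (f (x i) + (k + 1 - n.+3./2) <= f (x i.+1))%N.
  move=> i_lt; have := f_dist i i.+1; have := x_lt i; have := x_lt i.+1.
  rewrite /cyclic_dist; lia.
have step2 i : (i.+2 < n.+3)%N ->
    (f (x i) + (2 * k + 3 - n.+3) <= f (x i.+2))%N.
  move=> i_lt; have := f_dist i i.+1; have := f_dist i.+1 i.+2.
  (* This excludes two consecutive antipodal steps. *)
  have : x i != x i.+2 by apply: x_neq; lia.
  rewrite -val_eqE /=.
  have := x_lt i; have := x_lt i.+1; have := x_lt i.+2.
  rewrite /cyclic_dist; lia.
have f_even j : (j.*2 < n.+3)%N ->
    (f (x 0%N) + j * (2 * k + 3 - n.+3) <= f (x j.*2))%N.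
  elim: j => [|j IHj] j_lt; first by rewrite mul0n addn0.
  rewrite doubleS; have := step2 j.*2; rewrite doubleS in j_lt.
  rewrite mulSn; lia.
apply: leq_trans (leq_span _ f (x n.+2) (x 0%N)).
rewrite /cycle_radio_number -[n.+3.-1]/n.+2; have := f_even n.+2./2.
set S := (2 * k + 3 - n.+3)%N in step2 f_even *.
have [n_odd|n_even] := boolP (odd n.+3).
  have -> : (n.+2./2.*2 = n.+2)%N by lia.
  rewrite mul0n; lia.
(* For an even number of vertices the double steps stop at the vertex before the last, and [step1]
   supplies the final step. *)
have -> : (n.+2./2.*2 = n.+1)%N by lia.
have := step1 n.+1; rewrite mul1n; lia.
Qed.

(** * A labeling that attains the bound *)

Lemma cycle_labeling_le (n k v : nat) : (2 < n)%N -> (v < n)%N ->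
  (cycle_labeling n k v <= cycle_radio_number n k)%N.
Proof.
rewrite /cycle_labeling /cycle_radio_number => n_gt2 vn.
set S := (2 * k + 3 - n)%N; set c := (k + 1 - n./2)%N.
have [n_odd|n_even] := boolP (odd n); rewrite /= ?mul0n ?mul1n ?addn0.
  have cS : (c <= S)%N by rewrite /c /S; lia.
  case: ltnP => vh; first by rewrite leq_mul2r; apply/orP; right; lia.
  (* For odd n the upper half has one vertex fewer, so rounding [c] up to a full [S] stays within
     the bound. *)
  apply: leq_trans (_ : (v - uphalf n).+1 * S <= _)%N.
    by rewrite mulSn addnC leq_add2r.
  by rewrite leq_mul2r; apply/orP; right; lia.
case: ltnP => vh; last by rewrite leq_add2r leq_mul2r; apply/orP; right; lia.
by apply: leq_trans (leq_addr _ _); rewrite leq_mul2r; apply/orP; right; lia.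
Qed.

(** A label gap of at least k suffices, as distinct vertices are at distance at least 1. Only
    neighbours in the order 0, h, 1, h + 1, ... can have a smaller gap, and for them distance and
    gap add up to exactly k + 1. The sum of the two truncated differences is the absolute
    difference. *)
Lemma cycle_labeling_radio (n k u v : nat) :
    (2 < n)%N -> (n - 3 <= k)%N -> (0 < k)%N -> (u < v < n)%N ->
  (k + 1 <= cyclic_dist n u v +
    ((cycle_labeling n k v - cycle_labeling n k u) +
     (cycle_labeling n k u - cycle_labeling n k v)))%N.
Proof.
move=> n_gt2 nk k_gt0 /andP[uv vn].
rewrite cyclic_distE; last exact: ltnW.
have d_gt0 : (0 < minn (v - u) (n - (v - u)))%N by lia.
rewrite /cycle_labeling.
set S := (2 * k + 3 - n)%N; set c := (k + 1 - n./2)%N.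
set h := uphalf n.
(* This is where k >= n - 3 enters: S - k = k + 3 - n. *)
have kS : (k <= S)%N by rewrite /S; lia.
case: ltnP => vh; case: ltnP => uh; try by lia.
- have : (S <= v * S - u * S)%N.
    by rewrite -mulnBl leq_pmull // subn_gt0.
  lia.
- have [vu|vu] := leqP u (v - h)%N.
    (* The step from u to u + h: gap [c], distance [n./2]. *)
    have [->|uv'] := eqVneq u (v - h)%N.
      rewrite /c; lia.
    have : (S <= (v - h) * S - u * S)%N.
      by rewrite -mulnBl leq_pmull // subn_gt0; lia.
    lia.
  (* The step from v back to v - h + 1: gap [S - c], distance h - 1. Beyond it the gap is at least
     2S - c. *)
  have [uE|uv'] := eqVneq u (v - h).+1%N.
    rewrite uE mulSn /S /c; lia.
  have : (2 * S <= u * S - (v - h) * S)%N.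
    by rewrite -mulnBl leq_mul2r; apply/orP; right; lia.
  rewrite /S /c; lia.
- have : (S <= (v - h) * S - (u - h) * S)%N.
    by rewrite -mulnBl leq_pmull // subn_gt0; lia.
  lia.
Qed.

Lemma radio_number_cycle (n k : nat) : (2 < n)%N -> (0 < k)%N -> (n - 3 <= k)%N ->
  radio_number (@cycle_graph n) k = cycle_radio_number n k.
Proof.
case: n => [|[|[|n]]] // _ k_gt0 nk.
have lower f : radio_labeling (@cycle_graph n.+3) k f ->
    (cycle_radio_number n.+3 k <= Defs.span f)%N.
  by apply: cycle_span_lower_bound; lia.
rewrite /radio_number; case: ex_minnP => m /asboolP[f fL <-] min_f.
apply/eqP; rewrite eqn_leq lower // andbT.
pose g (u : 'Z_n.+3) := cycle_labeling n.+3 k u.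
have gL : radio_labeling (@cycle_graph n.+3) k g.
  move=> u v; rewrite -val_eqE /= cycle_dist /g.
  have uP : (u < n.+3)%N := ltn_ord u.
  have vP : (v < n.+3)%N := ltn_ord v.
  case: ltngtP => // uv _.
    have := cycle_labeling_radio n.+3 k u v isT nk k_gt0; lia.
  rewrite cyclic_distC.
  have := cycle_labeling_radio n.+3 k v u isT nk k_gt0; lia.
apply: leq_trans (min_f (Defs.span g) _) _; first by apply/asboolP; exists g.
by apply: span_leq => u; apply: cycle_labeling_le => //; apply: ltn_ord.
Qed.

Theorem theorem3p2 (n k : nat) (hn : (3 <= n)%N) (hk : (0 < k)%N)
    (hkn : (n - 3 <= k)%N) :
  (radio_number (@cycle_graph n) k)%:R =
    (if odd n
     then (n%:R - 1) / 2 * (2 * k%:R + 3 - n%:R)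
     else (n%:R - 2) / 2 * (2 * k%:R + 3 - n%:R) + k%:R - n%:R / 2 + 1)
  :> rat.
Proof.
rewrite radio_number_cycle // /cycle_radio_number.
have S_E : (2 * k + 3 - n)%:R = 2 * k%:R + 3 - n%:R :> rat.
  rewrite natrB; last lia.
  by rewrite natrD natrM.
case: (boolP (odd n)) => n_parity /=.
  (* Parity makes the rounded halves exact, so that they can be cast to rationals. *)
  have n_E : n = (n.-1./2 * 2 + 1)%N by lia.
  rewrite mul0n addn0 natrM S_E [in n%:R - 1]n_E natrD natrM.
  by field.
have n_E : n = (n./2 * 2)%N by lia.
have n_E' : n = (n.-1./2 * 2 + 2)%N by lia.
have h_le : (n./2 <= k + 1)%N by lia.
rewrite mul1n natrD natrM S_E (natrB _ h_le) natrD.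
rewrite [in n%:R - 2]n_E' [in n%:R / 2]n_E natrD !natrM.
by field.
Qed.
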